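(* For $\gamma\ge1$ let $\mathbb{K}\langle\mathbf{CAs}^{(\gamma)}\rangle:=\mathbb{K}\langle \mathbf{Mag}\rangle/_{I_\gamma}$, where $I_\gamma$ is the operad ideal generated by $\mathrm{LComb}_\gamma-\mathrm{RComb}_\gamma$, and let $\mathbb{K}\langle\mathbf{CAs}\rangle$ be the set of these operads. Write $\mathbb{K}\langle\mathbf{CAs}^{(\gamma)}\rangle\preceq_{\mathrm{d}}\mathbb{K}\langle\mathbf{CAs}^{(\gamma')}\rangle$ when there exists a nonzero morphism of linear operads $\mathbb{K}\langle\mathbf{CAs}^{(\gamma')}\rangle\to\mathbb{K}\langle\mathbf{CAs}^{(\gamma)}\rangle$. Then the inclusion $\iota:(\mathbb{K}\langle\mathbf{CAs}\rangle,\preceq_{\mathrm{d}})\to(\mathcal{Q},\preceq_{\mathrm{i}})$ is nondecreasing. Moreover, for all positive integers $\gamma,\gamma'$, $$\mathbb{K}\langle\mathbf{CAs}^{(\gcd(\gamma-1,\gamma'-1)+1)}\rangle\preceq_{\mathrm{i}}\mathbb{K}\langle\mathbf{CAs}^{(\gamma)}\rangle\wedge_{\mathrm{i}}\mathbb{K}\langle\mathbf{CAs}^{(\gamma')}\rangle$$ and $$\mathbb{K}\langle\mathbf{CAs}^{(\gamma)}\rangle\vee_{\mathrm{i}}\mathbb{K}\langle\mathbf{CAs}^{(\gamma')}\rangle\preceq_{\mathrm{i}}\mathbb{K}\langle\mathbf{CAs}^{(\mathrm{lcm}(\gamma-1,\gamma'-1)+1)}\rangle.$$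
   Context: $\mathbb{K}$ is a field of characteristic zero. A binary tree is either the leaf or an ordered pair of binary trees; $\mathbf{Mag}(n)$ is the set of binary trees with $n$ leaves and the nonsymmetric operad $\mathbf{Mag}$ has partial compositions grafting a tree's root onto the $i$-th leaf of another. $\mathbb{K}\langle \mathbf{Mag}\rangle$ is the linear operad with $\mathbb{K}\langle \mathbf{Mag}\rangle(n)$ having basis $\mathbf{Mag}(n)$. Combs: $\mathrm{LComb}_1=\mathrm{RComb}_1=(\text{leaf},\text{leaf})$, $\mathrm{LComb}_d=(\mathrm{LComb}_{d-1},\text{leaf})$, $\mathrm{RComb}_d=(\text{leaf},\mathrm{RComb}_{d-1})$. An operad ideal is a family of subspaces $I(n)$ stable under partial compositions with arbitrary elements on either side. $\mathcal{Q}$ is the set of quotients $\mathbb{K}\langle \mathbf{Mag}\rangle/_I$ over all operad ideals $I$. For $\mathcal{O}_j=\mathbb{K}\langle \mathbf{Mag}\rangle/_{I_j}$: $\mathcal{O}_2\preceq_{\mathrm{i}}\mathcal{O}_1$ iff there exists a nonzero morphism of linear operads $\mathcal{O}_1\to\mathcal{O}_2$ (arity-preserving linear maps commuting with partial compositions, nonzero on the binary generator); $\mathcal{O}_1\wedge_{\mathrm{i}}\mathcal{O}_2:=\mathbb{K}\langle \mathbf{Mag}\rangle/_{I_1+I_2}$ and $\mathcal{O}_1\vee_{\mathrm{i}}\mathcal{O}_2:=\mathbb{K}\langle \mathbf{Mag}\rangle/_{I_1\cap I_2}$. $\gcd$, $\mathrm{lcm}$ on $\mathbb{N}$ with $\gcd(0,a)=a$,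 $\mathrm{lcm}(0,a)=0$. *)

(* Defs.v *)
(* Submodules are boolean predicates; those defined by a proposition are
   obtained with the classical reflection `[< P >] of boolp. *)
From HB Require Import structures.
From mathcomp Require Import all_boot all_order all_algebra ring_quotient.
From mathcomp Require Import finmap monalg.
From mathcomp Require Import boolp.

Set Warnings "-redundant-canonical-projection".
Set Implicit Arguments.
Unset Strict Implicit.
Unset Printing Implicit Defensive.

Import GRing.Theory.
Local Open Scope ring_scope.

(* A nonsymmetric linear operad.  Inputs are numbered from 0, so [pcomp i] is
   the usual partial composition at input i + 1; its result has arity
   n + m - 1.  Both sides of an axiom may live in arities that are only
   provably equal, hence the comparison in the total space {n & P n}.  In the
   axioms the intermediate positions are ordinals with prescribed values. *)
Record operad (K : fieldType) := Operad {
  oper :> nat -> lmodType K;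
  oid : oper 1;
  pcomp : forall n m, 'I_n -> oper n -> oper m -> oper (n + m).-1;
  pcomp_linl : forall n m (i : 'I_n) (y : oper m),
    linear (fun x => pcomp i x y);
  pcomp_linr : forall n m (i : 'I_n) (x : oper n),
    linear (fun y : oper m => pcomp i x y);
  pcomp1o : forall n (x : oper n), pcomp ord0 oid x = x;
  pcompo1 : forall n (i : 'I_n) (x : oper n),
    Tagged oper (pcomp i x oid) = Tagged oper x;
  pcomp_seq : forall n m p (i : 'I_n) (j : 'I_m) (k : 'I_(n + m).-1)
      (x : oper n) (y : oper m) (z : oper p),
    k = (i + j)%N :> nat ->
    Tagged oper (pcomp k (pcomp i x y) z) =
    Tagged oper (pcomp i x (pcomp j y z));
  pcomp_par : forall n m p (i j : 'I_n)
      (j' : 'I_(n + m).-1) (i' : 'I_(n + p).-1)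
      (x : oper n) (y : oper m) (z : oper p),
    (i < j)%N -> j' = (j + m).-1 :> nat -> i' = i :> nat ->
    Tagged oper (pcomp j' (pcomp i x y) z) =
    Tagged oper (pcomp i' (pcomp j x z) y)
}.

Record operad_morphism (K : fieldType) (P Q : operad K) := OperadMorphism {
  omor :> forall n, {linear P n -> Q n};
  omor_id : omor 1 (oid P) = oid Q;
  omor_comp : forall n m (i : 'I_n) (x : P n) (y : P m),
    omor (n + m).-1 (pcomp i x y) = pcomp i (omor n x) (omor m y)
}.

Record operad_ideal (K : fieldType) (P : operad K) := OperadIdeal {
  oideal :> forall n, submodClosed (P n);
  oideal_compl : forall n m (i : 'I_n) (x : P n) (y : P m),
    x \in oideal n -> pcomp i x y \in oideal (n + m).-1;
  oideal_compr : forall n m (i : 'I_n) (x : P n) (y : P m),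
    y \in oideal m -> pcomp i x y \in oideal (n + m).-1
}.

Section Ideals.
Variables (K : fieldType) (P : operad K).
Implicit Types I J : operad_ideal P.

Lemma pcompDl n m (i : 'I_n) (x x' : P n) (y : P m) :
  pcomp i (x + x') y = pcomp i x y + pcomp i x' y.
Proof. by have /= := pcomp_linl i y 1 x x'; rewrite !scale1r. Qed.

Lemma pcompDr n m (i : 'I_n) (x : P n) (y y' : P m) :
  pcomp i x (y + y') = pcomp i x y + pcomp i x y'.
Proof. by have /= := pcomp_linr i x 1 y y'; rewrite !scale1r. Qed.

Lemma pcompBl n m (i : 'I_n) (x x' : P n) (y : P m) :
  pcomp i (x - x') y = pcomp i x y - pcomp i x' y.
Proof.
by have /= := pcomp_linl i y (-1) x' x; rewrite !scaleN1r ![- _ + _]addrC.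
Qed.

Lemma pcompBr n m (i : 'I_n) (x : P n) (y y' : P m) :
  pcomp i x (y - y') = pcomp i x y - pcomp i x y'.
Proof.
by have /= := pcomp_linr i x (-1) y' y; rewrite !scaleN1r ![- _ + _]addrC.
Qed.

Section Gen.
Variables (k : nat) (z : P k).

Definition gen_pred n : {pred P n} :=
  fun x => `[< forall J, z \in J k -> x \in J n >].

Fact gen_submod n : submod_closed (@gen_pred n).
Proof.
split=> [|a x y /asboolP hx /asboolP hy]; apply/asboolP => J zJ.
  exact: rpred0.
by rewrite rpredD ?rpredZ ?hx ?hy.
Qed.
HB.instance Definition _ n :=
  GRing.isSubmodClosed.Build K (P n) (@gen_pred n) (@gen_submod n).

Fact gen_compl n m (i : 'I_n) (x : P n) (y : P m) :
  x \in @gen_pred n -> pcomp i x y \in @gen_pred (n + m).-1.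
Proof. by move=> /asboolP hx; apply/asboolP => J /hx; apply: oideal_compl. Qed.

Fact gen_compr n m (i : 'I_n) (x : P n) (y : P m) :
  y \in @gen_pred m -> pcomp i x y \in @gen_pred (n + m).-1.
Proof. by move=> /asboolP hy; apply/asboolP => J /hy; apply: oideal_compr. Qed.

(* The ideal generated by z, as the intersection of all ideals containing z. *)
Definition gen_ideal : operad_ideal P :=
  @OperadIdeal K P (fun n => @gen_pred n) gen_compl gen_compr.
End Gen.

Section SumCap.
Variables I J : operad_ideal P.

Definition sum_pred n : {pred P n} :=
  fun x => `[< exists u v, [/\ u \in I n, v \in J n & x = u + v] >].
Definition cap_pred n : {pred P n} := fun x => (x \in I n) && (x \in J n).

Fact sum_submod n : submod_closed (@sum_pred n).
Proof.
split=> [|a _ _ /asboolP[u [v [hu hv ->]]] /asboolP[u' [v' [hu' hv' ->]]]].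
  by apply/asboolP; exists 0, 0; rewrite !rpred0 addr0.
apply/asboolP; exists (a *: u + u'), (a *: v + v').
by rewrite !(rpredD, rpredZ) // scalerDr addrACA.
Qed.
HB.instance Definition _ n :=
  GRing.isSubmodClosed.Build K (P n) (@sum_pred n) (@sum_submod n).

Fact cap_submod n : submod_closed (@cap_pred n).
Proof.
split=> [|a x y /andP[xI xJ] /andP[yI yJ]]; apply/andP; first by rewrite !rpred0.
by rewrite !(rpredD, rpredZ).
Qed.
HB.instance Definition _ n :=
  GRing.isSubmodClosed.Build K (P n) (@cap_pred n) (@cap_submod n).

Fact sum_compl n m (i : 'I_n) (x : P n) (y : P m) :
  x \in @sum_pred n -> pcomp i x y \in @sum_pred (n + m).-1.
Proof.
move=> /asboolP[u [v [hu hv ->]]]; apply/asboolP.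
by exists (pcomp i u y), (pcomp i v y); rewrite !oideal_compl // pcompDl.
Qed.

Fact sum_compr n m (i : 'I_n) (x : P n) (y : P m) :
  y \in @sum_pred m -> pcomp i x y \in @sum_pred (n + m).-1.
Proof.
move=> /asboolP[u [v [hu hv ->]]]; apply/asboolP.
by exists (pcomp i x u), (pcomp i x v); rewrite !oideal_compr // pcompDr.
Qed.

Definition sum_ideal : operad_ideal P :=
  @OperadIdeal K P (fun n => @sum_pred n) sum_compl sum_compr.

Fact cap_compl n m (i : 'I_n) (x : P n) (y : P m) :
  x \in @cap_pred n -> pcomp i x y \in @cap_pred (n + m).-1.
Proof. by move=> /andP[xI xJ]; apply/andP; rewrite !oideal_compl. Qed.

Fact cap_compr n m (i : 'I_n) (x : P n) (y : P m) :
  y \in @cap_pred m -> pcomp i x y \in @cap_pred (n + m).-1.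
Proof. by move=> /andP[yI yJ]; apply/andP; rewrite !oideal_compr. Qed.

Definition cap_ideal : operad_ideal P :=
  @OperadIdeal K P (fun n => @cap_pred n) cap_compl cap_compr.
End SumCap.
End Ideals.

(* The quotient of a module by a submodule: the quotient group of
   ring_quotient, with the induced scaling. *)
Section LmodQuotient.
Local Open Scope quotient_scope.
Variables (K : fieldType) (V : lmodType K) (S : submodClosed V).

(* Over a ring a submodule is also closed under opposites. *)
Definition lquot_pred : {pred V} := fun x => x \in S.
Fact lquot_pred_zmod : zmod_closed lquot_pred.
Proof.
split=> [|x y xS yS]; first exact: rpred0 S.
by rewrite -scaleN1r; apply: rpredD xS _; apply: rpredZ yS.
Qed.
HB.instance Definition _ := GRing.isZmodClosed.Build V lquot_pred lquot_pred_zmod.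

Definition lquot := @Quotient.quot V lquot_pred.
HB.instance Definition _ := Choice.on lquot.
HB.instance Definition _ := GRing.Zmodule.on lquot.
HB.instance Definition _ := EqQuotient.on lquot.
HB.instance Definition _ := ZmodQuotient.on lquot.

Definition lquot_pi (x : V) : lquot := \pi_lquot x.

Lemma lquot_ind (T : lquot -> Prop) : (forall x, T (lquot_pi x)) -> forall x, T x.
Proof. by move=> h x; rewrite -[x]reprK; apply: h. Qed.

Definition lquot_scale (a : K) (x : lquot) : lquot := lquot_pi (a *: repr x).

Lemma lquotE (x y : V) : (lquot_pi x == lquot_pi y) = (x - y \in S).
Proof. by rewrite -(Quotient.idealrBE lquot_pred). Qed.

Lemma lquot_reprB (x : V) : repr (lquot_pi x) - x \in S.
Proof. by rewrite -lquotE /lquot_pi reprK. Qed.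

Lemma lquot_piZ a x : lquot_pi (a *: x) = lquot_scale a (lquot_pi x).
Proof.
by apply/eqP; rewrite eq_sym lquotE -scalerBr rpredZ ?lquot_reprB.
Qed.

Lemma lquot_piD : {morph lquot_pi : x y / x + y >-> x + y}.
Proof. by move=> x y; rewrite /lquot_pi piE. Qed.

Fact lquot_scaleA a b x :
  lquot_scale a (lquot_scale b x) = lquot_scale (a * b) x.
Proof. by elim/lquot_ind: x => x; rewrite -!lquot_piZ scalerA. Qed.
Fact lquot_scale1 : left_id 1 lquot_scale.
Proof. by move=> x; elim/lquot_ind: x => x; rewrite -!lquot_piZ scale1r. Qed.
Fact lquot_scaleDr : right_distributive lquot_scale +%R.
Proof.
move=> a x y; elim/lquot_ind: x => x; elim/lquot_ind: y => y.
by rewrite -lquot_piD -!lquot_piZ scalerDr lquot_piD.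
Qed.
Fact lquot_scaleDl x : {morph lquot_scale^~ x : a b / a + b}.
Proof.
by move=> a b; elim/lquot_ind: x => x; rewrite -!lquot_piZ scalerDl lquot_piD.
Qed.
HB.instance Definition _ := GRing.Zmodule_isLmodule.Build K lquot
  lquot_scaleA lquot_scale1 lquot_scaleDr lquot_scaleDl.

Fact lquot_pi_linear : linear lquot_pi.
Proof.
by move=> a x y; rewrite lquot_piD lquot_piZ.
Qed.
HB.instance Definition _ :=
  GRing.isLinear.Build K V lquot *:%R lquot_pi lquot_pi_linear.

Lemma lquot_piP (x y : V) : reflect (lquot_pi x = lquot_pi y) (x - y \in S).
Proof. by rewrite -lquotE; apply: eqP. Qed.
End LmodQuotient.

Section OperadQuotient.
Variables (K : fieldType) (P : operad K) (I : operad_ideal P).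

Definition oquot n : lmodType K := lquot (I n).
Definition oquot_pi n : P n -> oquot n := @lquot_pi K (P n) (I n).

Lemma oquot_ind n (T : oquot n -> Prop) :
  (forall x, T (oquot_pi x)) -> forall x, T x.
Proof. exact: lquot_ind. Qed.

Lemma oquot_piP n (x y : P n) :
  reflect (oquot_pi x = oquot_pi y) (x - y \in I n).
Proof. exact: lquot_piP. Qed.

Definition oquot_comp n m (i : 'I_n) (x : oquot n) (y : oquot m)
    : oquot (n + m).-1 :=
  oquot_pi (pcomp i (repr x : P n) (repr y : P m)).

Lemma oquot_piC n m (i : 'I_n) (x : P n) (y : P m) :
  oquot_comp i (oquot_pi x) (oquot_pi y) = oquot_pi (pcomp i x y).
Proof.
rewrite /oquot_comp; apply/oquot_piP; set x' := repr _; set y' := repr _.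
have hx : x' - x \in I n by exact: lquot_reprB.
have hy : y' - y \in I m by exact: lquot_reprB.
rewrite -(subrKA (pcomp i x y')) -pcompBl -pcompBr.
by apply: rpredD; [apply: oideal_compl | apply: oideal_compr].
Qed.

Lemma oquot_pi_linear n : linear (@oquot_pi n).
Proof. exact: lquot_pi_linear. Qed.

Fact oquot_linl n m (i : 'I_n) (y : oquot m) :
  linear (fun x => oquot_comp i x y).
Proof.
move=> a x x'; elim/oquot_ind: x => x; elim/oquot_ind: x' => x'.
elim/oquot_ind: y => y.
by rewrite -oquot_pi_linear !oquot_piC -oquot_pi_linear pcomp_linl.
Qed.

Fact oquot_linr n m (i : 'I_n) (x : oquot n) :
  linear (fun y : oquot m => oquot_comp i x y).
Proof.
move=> a y y'; elim/oquot_ind: y => y; elim/oquot_ind: y' => y'.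
elim/oquot_ind: x => x.
by rewrite -oquot_pi_linear !oquot_piC -oquot_pi_linear pcomp_linr.
Qed.

Lemma oquot_Tagged n m (x : P n) (y : P m) :
  Tagged (oper P) x = Tagged (oper P) y -> Tagged oquot (oquot_pi x) = Tagged oquot (oquot_pi y).
Proof.
exact: (@congr1 _ _ (fun u : {n & P n} => Tagged oquot (oquot_pi (tagged u)))
  (Tagged (oper P) x) (Tagged (oper P) y)).
Qed.

Fact oquot_comp1o n (x : oquot n) :
  oquot_comp ord0 (oquot_pi (oid P)) x = x.
Proof. by elim/oquot_ind: x => x; rewrite oquot_piC pcomp1o. Qed.

Fact oquot_compo1 n (i : 'I_n) (x : oquot n) :
  Tagged oquot (oquot_comp i x (oquot_pi (oid P))) = Tagged oquot x.
Proof.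
elim/oquot_ind: x => x; rewrite oquot_piC.
exact/oquot_Tagged/pcompo1.
Qed.

Fact oquot_comp_seq n m p (i : 'I_n) (j : 'I_m) (k : 'I_(n + m).-1)
    (x : oquot n) (y : oquot m) (z : oquot p) :
  k = (i + j)%N :> nat ->
  Tagged oquot (oquot_comp k (oquot_comp i x y) z) =
  Tagged oquot (oquot_comp i x (oquot_comp j y z)).
Proof.
elim/oquot_ind: x => x; elim/oquot_ind: y => y; elim/oquot_ind: z => z kE.
by rewrite !oquot_piC; apply/oquot_Tagged/pcomp_seq.
Qed.

Fact oquot_comp_par n m p (i j : 'I_n)
    (j' : 'I_(n + m).-1) (i' : 'I_(n + p).-1)
    (x : oquot n) (y : oquot m) (z : oquot p) :
  (i < j)%N -> j' = (j + m).-1 :> nat -> i' = i :> nat ->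
  Tagged oquot (oquot_comp j' (oquot_comp i x y) z) =
  Tagged oquot (oquot_comp i' (oquot_comp j x z) y).
Proof.
elim/oquot_ind: x => x; elim/oquot_ind: y => y; elim/oquot_ind: z => z *.
by rewrite !oquot_piC; apply/oquot_Tagged/pcomp_par.
Qed.

Definition quot_operad : operad K :=
  @Operad K oquot (oquot_pi (oid P)) oquot_comp oquot_linl oquot_linr
    oquot_comp1o oquot_compo1 oquot_comp_seq oquot_comp_par.
End OperadQuotient.

Inductive btree := Leaf | Node of btree & btree.

Fixpoint btree_code (t : btree) : GenTree.tree unit :=
  if t is Node l r then GenTree.Node 0 [:: btree_code l; btree_code r]
  else GenTree.Leaf tt.
Fixpoint btree_decode (c : GenTree.tree unit) : btree :=
  if c is GenTree.Node _ [:: l; r] then Node (btree_decode l) (btree_decode r)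
  else Leaf.
Fact btree_codeK : cancel btree_code btree_decode.
Proof. by elim=> //= l -> r ->. Qed.
HB.instance Definition _ := Countable.copy btree (can_type btree_codeK).

Fixpoint nleaves (t : btree) : nat :=
  if t is Node l r then (nleaves l + nleaves r)%N else 1.

(* [graft s i t] grafts the root of t onto the leaf of s with index i, leaves
   being numbered from left to right starting at 0. *)
Fixpoint graft (s : btree) (i : nat) (t : btree) : btree :=
  if s is Node l r then
    if (i < nleaves l)%N then Node (graft l i t) r
    else Node l (graft r (i - nleaves l) t)
  else t.

Fixpoint lcomb (d : nat) : btree :=
  if d is d'.+1 then Node (lcomb d') Leaf else Leaf.
Fixpoint rcomb (d : nat) : btree :=
  if d is d'.+1 then Node Leaf (rcomb d') else Leaf.

Lemma nleaves_gt0 t : (0 < nleaves t)%N.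
Proof. by elim: t => //= l hl r hr; rewrite addn_gt0 hl. Qed.

Lemma nleaves_graft s i t : (i < nleaves s)%N ->
  nleaves (graft s i t) = (nleaves s + nleaves t).-1.
Proof.
elim: s i => [|l IHl r IHr] i /=; first by case: i.
have := nleaves_gt0 l; have := nleaves_gt0 r; have := nleaves_gt0 t.
case: (ltnP i (nleaves l)) => hi t0 r0 l0 hlt /=.
  rewrite IHl // -(prednK t0) !addnS /=.
  by rewrite addnAC.
rewrite IHr; last by rewrite ltn_subLR.
by rewrite -(prednK t0) !addnS /= addnA.
Qed.

Lemma graft_leaf s i : graft s i Leaf = s.
Proof.
elim: s i => //= l IHl r IHr i.
by case: ifP => _; rewrite ?IHl ?IHr.
Qed.

Lemma graft_seq s t u i j : (i < nleaves s)%N -> (j < nleaves t)%N ->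
  graft (graft s i t) (i + j) u = graft s i (graft t j u).
Proof.
move=> + hj; elim: s i => [|l IHl r IHr] i /=; first by case: i.
have [hi _|hi hlt] /= := ltnP i (nleaves l).
  rewrite nleaves_graft //; have -> /= : (i + j < (nleaves l + nleaves t).-1)%N.
    by rewrite -ltnS prednK ?addn_gt0 ?nleaves_gt0 // -addnS -addSn leq_add.
  by rewrite IHl.
rewrite ltnNge (leq_trans hi) ?leq_addr //= -addnBAC //.
by rewrite IHr ?ltn_subLR.
Qed.

Lemma graft_par s t u i j : (i < j)%N -> (j < nleaves s)%N ->
  graft (graft s i t) (j + nleaves t).-1 u = graft (graft s j u) i t.
Proof.
have t0 := nleaves_gt0 t; have u0 := nleaves_gt0 u.
elim: s i j => [|l IHl r IHr] i j hij /=.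
  by rewrite ltnS leqn0 => /eqP j0; rewrite j0 in hij.
have predE : (j + nleaves t).-1 = (j + (nleaves t).-1)%N.
  by rewrite -(prednK t0) addnS.
have [hj _|hj hlt] := ltnP j (nleaves l).
  have hi := ltn_trans hij hj; rewrite hi /= !nleaves_graft //.
  rewrite -(prednK u0) -(prednK t0) !addnS /= ltn_add2r hj.
  rewrite (leq_trans hi) ?leq_addr //.
  by have := IHl i j hij hj; rewrite predE => ->.
have [hi|hi] /= := ltnP i (nleaves l).
  rewrite nleaves_graft // -(prednK t0) !addnS /= ltn_add2r ltnNge hj /=.
  by rewrite subnDr hi.
rewrite ltnNge (leq_trans hj) /=; last by rewrite predE leq_addr.
rewrite ltnNge hi /=.
rewrite predE -addnBAC //.
have -> : (j - nleaves l + (nleaves t).-1 = (j - nleaves l + nleaves t).-1)%N.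
  by rewrite -[in RHS](prednK t0) addnS.
by rewrite IHr ?ltn_subLR ?subnKC.
Qed.

Lemma nleaves_lcomb d : nleaves (lcomb d) = d.+1.
Proof. by elim: d => //= d ->; rewrite addn1. Qed.
Lemma nleaves_rcomb d : nleaves (rcomb d) = d.+1.
Proof. by elim: d => //= d ->; rewrite add1n. Qed.

Record mag (n : nat) := Mag { mag_tree :> btree; _ : nleaves mag_tree == n }.
HB.instance Definition _ n := [isSub for @mag_tree n].
HB.instance Definition _ n := [Countable of mag n by <:].

Fact mag_graft_subproof n m (s : mag n) (i : 'I_n) (t : mag m) :
  nleaves (graft s i t) == (n + m).-1.
Proof.
rewrite nleaves_graft ?(eqP (valP s)) ?(eqP (valP t)) //.
Qed.
Definition mag_graft n m (s : mag n) (i : 'I_n) (t : mag m) : mag (n + m).-1 :=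
  Mag (mag_graft_subproof s i t).

Definition mag_leaf : mag 1 := @Mag 1 Leaf (eqxx _).
Definition mag_corolla : mag 2 := @Mag 2 (Node Leaf Leaf) (eqxx _).
Definition mag_lcomb d : mag d.+1 := Mag (introT eqP (nleaves_lcomb d)).
Definition mag_rcomb d : mag d.+1 := Mag (introT eqP (nleaves_rcomb d)).

Section LinearExtension.
Variables (K : fieldType) (T : choiceType) (V : lmodType K).
Implicit Types (f : T -> V) (x : {malg K[T]}).

Definition lext f x : V := \sum_(t <- msupp x) x@_t *: f t.

Lemma lextw (d : {fset T}) f x : (msupp x `<=` d)%fset ->
  lext f x = \sum_(t <- d) x@_t *: f t.
Proof.
move=> le_d; rewrite /lext (big_fset_incl _ le_d) //= => t _ /mcoeff_outdom ->.
by rewrite scale0r.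
Qed.

Lemma lext_linear f : linear (lext f).
Proof.
move=> a x y; pose d := (msupp x `|` msupp y `|` msupp (a *: x + y))%fset.
have dx : (msupp x `<=` d)%fset by rewrite /d -fsetUA fsubsetUl.
have dy : (msupp y `<=` d)%fset by rewrite /d fsetUAC fsubsetUr.
have dz : (msupp (a *: x + y) `<=` d)%fset by rewrite fsubsetUr.
rewrite (lextw f dx) (lextw f dy) (lextw f dz).
rewrite scaler_sumr -big_split /=; apply: eq_bigr => t _.
by rewrite mcoeffD mcoeffZ scalerDl scalerA.
Qed.

Lemma lextU f t : lext f << t >> = f t.
Proof. by rewrite (lextw f msuppU_le) big_seq_fset1 mcoeffUU scale1r. Qed.

Lemma linear_malg_ext (g h : {malg K[T]} -> V) :
  linear g -> linear h -> (forall t, g << t >> = h << t >>) -> g =1 h.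
Proof.
suff E (k : {malg K[T]} -> V) : linear k -> k =1 lext (fun t => k << t >>).
  move=> lg lh e x; rewrite (E g) // (E h) //.
  by apply: eq_bigr => t _; rewrite e.
move=> lk x; pose M := GRing.isLinear.Build _ _ _ _ k lk.
pose k' : {linear {malg K[T]} -> V} := HB.pack k M.
rewrite -[k]/(k' : _ -> _) [in LHS](monalgE x) linear_sum.
apply: eq_bigr => t _; rewrite -[RHS]linearZ; congr (k' _).
by apply/malgP => u; rewrite mcoeffZ !mcoeffU mulrnAr mulr1.
Qed.
End LinearExtension.

Section LinearMag.
Variable K : fieldType.

Definition kmag n : lmodType K := {malg K[mag n]}.

(* The bilinear extension of the grafting of trees. *)
Definition kmag_comp n m (i : 'I_n) (x : kmag n) (y : kmag m)
    : kmag (n + m).-1 :=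
  lext (fun s : mag n =>
    lext (fun t : mag m => << mag_graft s i t >> : kmag (n + m).-1) y) x.

Fact kmag_linl n m (i : 'I_n) (y : kmag m) : linear (fun x => kmag_comp i x y).
Proof. exact: lext_linear. Qed.

Fact kmag_linr n m (i : 'I_n) (x : kmag n) :
  linear (fun y : kmag m => kmag_comp i x y).
Proof.
move=> a y y'; rewrite /kmag_comp /lext scaler_sumr -big_split /=.
apply: eq_bigr => s _; rewrite -!/(lext _ _) lext_linear scalerDr.
by rewrite !scalerA mulrC.
Qed.

Lemma kmag_compU n m (i : 'I_n) (s : mag n) (t : mag m) :
  kmag_comp i << s >> << t >> = << mag_graft s i t >>.
Proof. by rewrite /kmag_comp !lextU. Qed.

Definition kcast n m (e : n = m) (x : kmag n) : kmag m := ecast k (kmag k) e x.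

Lemma kcast_linear n m (e : n = m) : linear (kcast e).
Proof. by case: m / e. Qed.

Lemma kcastU n m (e : n = m) (s : mag n) (t : mag m) :
  s = t :> btree -> kcast e << s >> = << t >>.
Proof. by case: m / e t => t st; rewrite /kcast /=; congr << _ >>; apply: val_inj. Qed.

Lemma Tagged_kcast n m (e : n = m) (x : kmag n) (y : kmag m) :
  kcast e x = y -> Tagged kmag x = Tagged kmag y.
Proof. by case: m / e y => y <-. Qed.

Fact kmag_comp1o n (x : kmag n) : kmag_comp ord0 << mag_leaf >> x = x.
Proof.
move: x; apply: linear_malg_ext => // [|t]; first exact: kmag_linr.
by rewrite kmag_compU; congr << _ >>; apply: val_inj.
Qed.

Fact kmag_compo1 n (i : 'I_n) (x : kmag n) :
  Tagged kmag (kmag_comp i x << mag_leaf >>) = Tagged kmag x.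
Proof.
have e : (n + 1).-1 = n by rewrite addn1.
apply: (@Tagged_kcast _ _ e); move: x; apply: linear_malg_ext => // [a x y|t].
  by rewrite kmag_linl kcast_linear.
by rewrite kmag_compU; apply: kcastU; rewrite /= graft_leaf.
Qed.

Fact kmag_comp_seq n m p (i : 'I_n) (j : 'I_m) (k : 'I_(n + m).-1)
    (x : kmag n) (y : kmag m) (z : kmag p) :
  k = (i + j)%N :> nat ->
  Tagged kmag (kmag_comp k (kmag_comp i x y) z) =
  Tagged kmag (kmag_comp i x (kmag_comp j y z)).
Proof.
move=> kE; have e : ((n + m).-1 + p).-1 = (n + (m + p).-1).-1.
  case: (n) (m) i j {k kE x y} => [|n'] [|m'] [] // i _ [] // j _.
  by rewrite !(addSn, addnS) /= ?(addSn, addnS) /= addnA.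
apply: (@Tagged_kcast _ _ e).
move: x; apply: linear_malg_ext => [a x x'|a x x'|s].
- by rewrite !kmag_linl kcast_linear.
- by rewrite kmag_linl.
move: y; apply: linear_malg_ext => [a y y'|a y y'|t].
- by rewrite kmag_linr kmag_linl kcast_linear.
- by rewrite kmag_linl kmag_linr.
move: z; apply: linear_malg_ext => [a z z'|a z z'|u].
- by rewrite kmag_linr kcast_linear.
- by rewrite !kmag_linr.
rewrite !kmag_compU; apply: kcastU; rewrite /= kE graft_seq //.
- by rewrite (eqP (valP s)).
- by rewrite (eqP (valP t)).
Qed.

Fact kmag_comp_par n m p (i j : 'I_n)
    (j' : 'I_(n + m).-1) (i' : 'I_(n + p).-1)
    (x : kmag n) (y : kmag m) (z : kmag p) :
  (i < j)%N -> j' = (j + m).-1 :> nat -> i' = i :> nat ->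
  Tagged kmag (kmag_comp j' (kmag_comp i x y) z) =
  Tagged kmag (kmag_comp i' (kmag_comp j x z) y).
Proof.
move=> hij j'E i'E; have e : ((n + m).-1 + p).-1 = ((n + p).-1 + m).-1.
  have : (1 < n)%N by apply: leq_ltn_trans (ltn_ord j); apply: leq_ltn_trans hij.
  case: (n) => [|[|n']] // _.
  by rewrite !addSn /= addnAC.
apply: (@Tagged_kcast _ _ e).
move: x; apply: linear_malg_ext => [a x x'|a x x'|s].
- by rewrite !kmag_linl kcast_linear.
- by rewrite !kmag_linl.
move: y; apply: linear_malg_ext => [a y y'|a y y'|t].
- by rewrite kmag_linr kmag_linl kcast_linear.
- by rewrite kmag_linr.
move: z; apply: linear_malg_ext => [a z z'|a z z'|u].
- by rewrite kmag_linr kcast_linear.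
- by rewrite kmag_linr kmag_linl.
rewrite !kmag_compU; apply: kcastU => /=.
rewrite j'E i'E -[in (j + m)%N](eqP (valP t)) graft_par //.
by rewrite (eqP (valP s)).
Qed.

Definition kmag_operad : operad K :=
  @Operad K kmag << mag_leaf >> kmag_comp kmag_linl kmag_linr
    kmag_comp1o kmag_compo1 kmag_comp_seq kmag_comp_par.
End LinearMag.

(* A quotient of the magmatic operad is given by an operad ideal; the coercion
   sends it to the actual quotient operad. *)
Record mag_quotient (K : fieldType) := MagQuotient {
  mq_ideal : operad_ideal (kmag_operad K)
}.

Definition mq_operad (K : fieldType) (q : mag_quotient K) : operad K :=
  quot_operad (mq_ideal q).
Coercion mq_operad : mag_quotient >-> operad.

Section MagQuotients.
Variable K : fieldType.
Implicit Types q : mag_quotient K.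

Definition mq_gen q : q 2 :=
  oquot_pi (mq_ideal q) (<< mag_corolla >> : kmag_operad K 2).

(* A morphism may kill everything except the unit; such a morphism counts as
   zero, which is why nonzeroness is tested on the binary generator. *)
Definition nonzero_morphism q1 q2 (phi : operad_morphism q1 q2) : Prop :=
  phi 2 (mq_gen q1) != 0.

Definition le_i q2 q1 : Prop :=
  exists phi : operad_morphism q1 q2, nonzero_morphism phi.

Definition meet_i q1 q2 : mag_quotient K :=
  MagQuotient (sum_ideal (mq_ideal q1) (mq_ideal q2)).
Definition join_i q1 q2 : mag_quotient K :=
  MagQuotient (cap_ideal (mq_ideal q1) (mq_ideal q2)).

Definition comb_relation (gamma : nat) : kmag_operad K gamma.+1 :=
  (<< mag_lcomb gamma >> : kmag K gamma.+1) - << mag_rcomb gamma >>.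

(* Only gamma >= 1 is meant: the combs of index 0 are junk values. *)
Definition CAs (gamma : nat) : mag_quotient K :=
  MagQuotient (gen_ideal (comb_relation gamma)).

Definition CAs_set : Type :=
  {q : mag_quotient K | exists2 gamma : nat, (0 < gamma)%N & q = CAs gamma}.

Definition CAs_incl (x : CAs_set) : mag_quotient K := proj1_sig x.

Definition le_d (x y : CAs_set) : Prop :=
  exists phi : operad_morphism (proj1_sig y) (proj1_sig x),
    nonzero_morphism phi.
End MagQuotients.

(* Main.v *)
(* If an ideal contains the comb relations of indices d + 1 and e + 1, then
   modulo it
     LComb_(d+e+1) = LComb_(d+1) o_0 LComb_e ~ RComb_(d+1) o_0 LComb_e
       = (LComb_e, RComb_d) = LComb_(e+1) o_(e+1) RComb_d
       ~ RComb_(e+1) o_(e+1) RComb_d = RComb_(d+e+1),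
   so it contains the relation of index d + e + 1.  Hence I_(e+1) is included
   in I_(d+1) whenever d divides e, and all the morphisms required are the
   canonical projections between quotients.  They do not kill the binary
   generator, because every I_gamma consists of elements whose coefficients
   sum to zero. *)
From HB Require Import structures.
From mathcomp Require Import all_boot all_order all_algebra.
From mathcomp Require Import monalg boolp.
Require Import Defs.

Set Implicit Arguments.
Unset Strict Implicit.
Unset Printing Implicit Defensive.

Import GRing.Theory.
Local Open Scope ring_scope.

Section Projection.
Variables (K : fieldType) (P : operad K) (I J : operad_ideal P).
Hypothesis subIJ : forall n (x : P n), x \in I n -> x \in J n.

Definition quot_proj n (x : quot_operad I n) : quot_operad J n :=
  oquot_pi J (repr (x : lquot (I n)) : P n).

(** The chosen representative of the class of [x] differs from [x] by an element of [I], hence of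
    [J], so the choice does not matter. *)
Lemma quot_proj_pi n (x : P n) : quot_proj (oquot_pi I x) = oquot_pi J x.
Proof. by apply/oquot_piP/subIJ/lquot_reprB. Qed.

Fact quot_proj_linear n : linear (@quot_proj n).
Proof.
move=> a x y; elim/oquot_ind: x => x; elim/oquot_ind: y => y.
by rewrite -oquot_pi_linear !quot_proj_pi -oquot_pi_linear.
Qed.
HB.instance Definition _ n :=
  GRing.isLinear.Build K _ _ *:%R (@quot_proj n) (@quot_proj_linear n).

Fact quot_proj_comp n m (i : 'I_n) (x : quot_operad I n) (y : quot_operad I m) :
  quot_proj (pcomp i x y) = pcomp i (quot_proj x) (quot_proj y).
Proof.
elim/oquot_ind: x => x; elim/oquot_ind: y => y.
by rewrite /pcomp /= oquot_piC !quot_proj_pi oquot_piC.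
Qed.

Definition quot_proj_morphism :
    operad_morphism (quot_operad I) (quot_operad J) :=
  @OperadMorphism K (quot_operad I) (quot_operad J)
    (fun n => @quot_proj n) (quot_proj_pi _) quot_proj_comp.
End Projection.

Section Augmentation.
Variable K : fieldType.

(** The projection onto the associative operad, one-dimensional in each positive arity: every tree
    goes to 1, so its kernel misses the binary generator. *)
Definition aug n (x : kmag K n) : K^o := lext (fun=> 1) x.

Lemma aug_linear n : linear (@aug n).
Proof. exact: lext_linear. Qed.
HB.instance Definition _ n :=
  GRing.isLinear.Build K (kmag K n) K^o *:%R (@aug n) (@aug_linear n).

Lemma augU n (t : mag n) : aug << t >> = 1.
Proof. exact: lextU. Qed.

Lemma aug_comp n m (i : 'I_n) (x : kmag K n) (y : kmag K m) :
  aug (kmag_comp i x y) = aug x *: aug y.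
Proof.
move: x; apply: linear_malg_ext => [a x x'|a x x'|s].
- by rewrite kmag_linl linearP.
- by rewrite linearP scalerDl -scalerA.
rewrite augU scale1r.
move: y; apply: linear_malg_ext => [a y y'|a y y'|t].
- by rewrite kmag_linr linearP.
- by rewrite linearP.
by rewrite kmag_compU !augU.
Qed.

Definition aug_pred n : {pred kmag_operad K n} := fun x => aug x == 0.

Fact aug_submod n : submod_closed (@aug_pred n).
Proof.
split=> [|a x y /eqP x0 /eqP y0]; rewrite /in_mem /= /aug_pred ?linear0 //.
by rewrite aug_linear x0 y0 scaler0 addr0.
Qed.
HB.instance Definition _ n := GRing.isSubmodClosed.Build K
  (kmag_operad K n) (@aug_pred n) (@aug_submod n).

Fact aug_compl n m (i : 'I_n) (x : kmag_operad K n) (y : kmag_operad K m) :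
  x \in @aug_pred n -> pcomp i x y \in @aug_pred (n + m).-1.
Proof. by move=> /eqP x0; apply/eqP; rewrite aug_comp x0 scale0r. Qed.

Fact aug_compr n m (i : 'I_n) (x : kmag_operad K n) (y : kmag_operad K m) :
  y \in @aug_pred m -> pcomp i x y \in @aug_pred (n + m).-1.
Proof. by move=> /eqP y0; apply/eqP; rewrite aug_comp y0 scaler0. Qed.

Definition aug_ideal : operad_ideal (kmag_operad K) :=
  @OperadIdeal K (kmag_operad K) (fun n => @aug_pred n) aug_compl aug_compr.
End Augmentation.

Lemma nleaves_mag n (t : mag n) : nleaves t = n.
Proof. by case: t => t /= /eqP. Qed.

Section IdealCongruence.
Variables (K : fieldType) (J : operad_ideal (kmag_operad K)).
Implicit Types s t : btree.

Definition mag_diff n (a b : mag n) : kmag_operad K n :=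
  (<< a >> : kmag K n) - << b >>.

Lemma mag_diffD n (a b c : mag n) :
  mag_diff a b + mag_diff b c = mag_diff a c.
Proof. exact: subrKA. Qed.

Lemma mag_diff_graft n m (i : 'I_n) (a b : mag n) (c : mag m) :
  pcomp i (mag_diff a b) (<< c >> : kmag K m) =
  mag_diff (mag_graft a i c) (mag_graft b i c).
Proof. by rewrite pcompBl /= !kmag_compU. Qed.

(** Hiding the arity lets trees whose leaf counts are only provably equal be compared and chained
    without casts. *)
Definition tree_cong s t : Prop := exists n (a b : mag n),
  [/\ a = s :> btree, b = t :> btree & mag_diff a b \in J n].

Lemma tree_cong_trans s t u : tree_cong s t -> tree_cong t u -> tree_cong s u.
Proof.
move=> [n [a [b [<- bt ab]]]] [m [b' [c [b't <- bc]]]].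
have e : n = m by rewrite -(nleaves_mag b) -(nleaves_mag b') bt b't.
subst m; exists n, a, c; split=> [//|//|].
have eb : b' = b by apply: val_inj; rewrite /= bt b't.
by rewrite -(mag_diffD a b c); apply: rpredD ab _; rewrite -eb.
Qed.

Lemma tree_cong_graft s s' i t :
  (i < nleaves s)%N -> tree_cong s s' -> tree_cong (graft s i t) (graft s' i t).
Proof.
move=> hi [n [a [b [as_ bs' ab]]]].
move: hi; rewrite -as_ -bs' nleaves_mag => hi.
pose c := @Mag _ t (eqxx _).
exists _, (mag_graft a (Ordinal hi) c), (mag_graft b (Ordinal hi) c).
by split=> [//|//|]; rewrite -mag_diff_graft; apply: oideal_compl ab.
Qed.

Lemma comb_relation_cong d :
  comb_relation K d \in J d.+1 <-> tree_cong (lcomb d) (rcomb d).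
Proof.
split=> [h|]; first by exists d.+1, (mag_lcomb d), (mag_rcomb d).
move=> [n [a [b [al br ab]]]].
have e : n = d.+1 by rewrite -(nleaves_mag a) al nleaves_lcomb.
subst n.
have ea : a = mag_lcomb d by apply: val_inj.
have eb : b = mag_rcomb d by apply: val_inj.
by move: ab; rewrite ea eb.
Qed.
End IdealCongruence.

Lemma graft_lcomb0 d e : graft (lcomb d) 0 (lcomb e) = lcomb (d + e).
Proof. by elim: d => //= d ->; rewrite nleaves_gt0. Qed.

Lemma graft_rcomb_last d e : graft (rcomb d) d (rcomb e) = rcomb (d + e).
Proof. by elim: d => //= d IHd; rewrite subn1 IHd. Qed.

Section CombRelations.
Variables (K : fieldType) (J : operad_ideal (kmag_operad K)).

Lemma comb_relationD d e :
    comb_relation K d.+1 \in J d.+2 -> comb_relation K e.+1 \in J e.+2 ->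
  comb_relation K (d + e).+1 \in J (d + e).+2.
Proof.
move=> /comb_relation_cong hd /comb_relation_cong he.
apply/comb_relation_cong/(@tree_cong_trans _ _ _ (Node (lcomb e) (rcomb d))).
  rewrite -addSn -graft_lcomb0.
  by have := tree_cong_graft (lcomb e) (nleaves_gt0 _) hd.
rewrite addnC -addSn -graft_rcomb_last.
have lt_e : (e.+1 < nleaves (lcomb e.+1))%N by rewrite nleaves_lcomb.
have := tree_cong_graft (rcomb d) lt_e he.
(* Leaf [e.+1], counted from 0, is the last one of [lcomb e.+1], that is, its right child, which the
   grafting replaces by [rcomb d]. *)
by rewrite [graft (lcomb _) _ _]/= nleaves_lcomb ltnn.
Qed.

Lemma comb_relation_dvdn d e : (d %| e)%N ->
  comb_relation K d.+1 \in J d.+2 -> comb_relation K e.+1 \in J e.+2.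
Proof.
move=> /dvdnP[k ->] hd; elim: k => [|k IHk]; last exact: comb_relationD.
(* For a zero multiple, both combs of index 1 are the corolla and the relation vanishes; this also
   covers [d = 0]. *)
rewrite mul0n /comb_relation.
have -> : mag_lcomb 1 = mag_rcomb 1 by apply: val_inj.
by rewrite subrr; apply: rpred0 (J 2).
Qed.
End CombRelations.

Section CombQuotients.
Variable K : fieldType.

(** The generator has coefficients 1 and -1, so [aug_ideal] is one of the ideals whose intersection
    is taken. *)
Lemma CAs_aug gamma n (x : kmag_operad K n) :
  x \in mq_ideal (CAs K gamma) n -> x \in aug_ideal K n.
Proof.
by move=> /asboolP; apply; apply/eqP; rewrite linearB /= !augU subrr.
Qed.

Lemma le_i_proj (q1 q2 : mag_quotient K) :
    (forall n (x : kmag_operad K n),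
       x \in mq_ideal q1 n -> x \in mq_ideal q2 n) ->
    (forall n (x : kmag_operad K n),
       x \in mq_ideal q2 n -> x \in aug_ideal K n) ->
  le_i q2 q1.
Proof.
move=> sub12 sub2; exists (quot_proj_morphism sub12).
rewrite /nonzero_morphism /= (quot_proj_pi sub12); apply/negP => /eqP.
(* If the class of the corolla were zero, the corolla would lie in the ideal of [q2], although its
   augmentation is 1. *)
rewrite -[0](raddf0 (@lquot_pi K _ (mq_ideal q2 2))) => /oquot_piP.
by rewrite subr0 => /sub2/eqP/eqP; rewrite augU oner_eq0.
Qed.

(** An ideal containing the relation of index [d.+1] contains that of index [e.+1], so the
    intersection defining the larger index runs over more ideals. *)
Lemma CAs_sub d e n (x : kmag_operad K n) : (d %| e)%N ->
  x \in mq_ideal (CAs K e.+1) n -> x \in mq_ideal (CAs K d.+1) n.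
Proof.
move=> de /asboolP hx; apply/asboolP => J hJ.
by apply: hx; apply: comb_relation_dvdn hJ.
Qed.
End CombQuotients.

Theorem theorem3p2p9 (K : fieldType) (charK : [pchar K] =i pred0) :
  [/\ {homo @CAs_incl K : x y / le_d x y >-> le_i x y},
      forall gamma gamma' : nat, (0 < gamma)%N -> (0 < gamma')%N ->
        le_i (CAs K (gcdn (gamma - 1) (gamma' - 1) + 1))
             (meet_i (CAs K gamma) (CAs K gamma'))
    & forall gamma gamma' : nat, (0 < gamma)%N -> (0 < gamma')%N ->
        le_i (join_i (CAs K gamma) (CAs K gamma'))
             (CAs K (lcmn (gamma - 1) (gamma' - 1) + 1))].
Proof.
(* Monotonicity holds by conversion, [le_d] being [le_i] on the underlying quotients. Writing each
   index as a successor absorbs the shifts by one. *)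
split=> [x y //|[//|g] [//|g'] _ _|[//|g] [//|g'] _ _]; rewrite !subn1 addn1 /=.
  apply: le_i_proj => n x; last exact: CAs_aug.
  move=> /asboolP[u [v [hu hv ->]]].
  (* The gcd divides [g] and [g'], so its ideal contains both summands. *)
  by rewrite rpredD ?(CAs_sub (dvdn_gcdl g g') hu) ?(CAs_sub (dvdn_gcdr g g') hv).
apply: le_i_proj => n x; last by move=> /andP[/CAs_aug].
(* The lcm is a multiple of [g] and of [g'], so its ideal lies in both. *)
by move=> hx; apply/andP; rewrite !(CAs_sub _ hx) ?dvdn_lcml ?dvdn_lcmr.
Qed.
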